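(* Assume the weak-inclusion case, i.e. $(\lambda_{\mathcal{D}_{\max}},\mu_{\mathcal{D}_{\max}})<(\lambda_{\mathcal{B}_{\min}},\mu_{\mathcal{B}_{\min}})$ componentwise, and that admissible data satisfy $(\lambda_0-\lambda_{\mathcal D}(x),\mu_0-\mu_{\mathcal D}(x))\ge (c^\lambda,c^\mu)$ for all $x\in\mathcal D$. For $s=1,\dots,N$ set $$\tau_s^{\lambda}:=\lambda_{\mathcal{B}_{\max}}\chi_{\Omega\setminus\omega_s}+\lambda_{\mathcal{D}_{\max}}\chi_{\omega_s},\qquad \tau_s^{\mu}:=\mu_{\mathcal{B}_{\max}}\chi_{\Omega\setminus\omega_s}+\mu_{\mathcal{D}_{\max}}\chi_{\omega_s}.$$ Consider the reconstruction method which marks each $\omega_s$, $s\in\{1,\dots,N\}$, for which $$\boldsymbol\Lambda(\tau_s^\lambda,\tau_s^\mu)-\delta \mathbf I\ \le\ \boldsymbol\Lambda^\delta(\lambda,\mu),$$ and defines the reconstruction $\mathcal D_R$ as the union of all marked $\omega_s$. Let $$\nu:=\min_{s=1,\dots,N}\Big(\max\big(\mathrm{eig}\big[\boldsymbol\Lambda(\tau_s^\lambda,\tau_s^\mu)-\boldsymbol\Lambda(\lambda_{\mathcal{B}_{\min}},\mu_{\mathcal{B}_{\min}})\big]\big)\Big).$$ If $\nu>2\delta\ge 0$, then this method fulfills the resolution guarantee with respect to the partition $(\omega_s)_{s=1,\dots,N}$.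
   Context: Domain and partition. $\Omega\subset\mathbb R^d$ ($d=2$ or $3$) is a bounded connected open set with Lipschitz, piecewise smooth boundary $\partial\Omega=\overline{\Gamma_{\mathrm D}\cup\Gamma_{\mathrm N}}$, where $\Gamma_{\mathrm D},\Gamma_{\mathrm N}$ are disjoint, nonempty, relatively open and connected. $(\omega_s)_{s=1,\dots,N}$ are disjoint open subsets of $\Omega$ with $\overline\Omega=\bigcup_{s}\overline{\omega_s}$. $\chi_A$ is the characteristic function of $A$. Elasticity problem and measurements. $L^\infty_+(\Omega)=\{w\in L^\infty(\Omega):\operatorname{ess\,inf} w>0\}$, $\hat\nabla u=\frac12(\nabla u+(\nabla u)^T)$, $\mathcal V=\{v\in H^1(\Omega)^d: v|_{\Gamma_{\mathrm D}}=0\}$. Let $\Gamma_{\mathrm N}^{(l)}\subseteq\Gamma_{\mathrm N}$, $l=1,\dots,M$, be disjoint patches and $g_l\in L^2(\Gamma_{\mathrm N})^d$ boundary forces supported in $\Gamma_{\mathrm N}^{(l)}$. For $\lambda,\mu\in L^\infty_+(\Omega)$ let $u^{(k)}=u^{(k)}_{(\lambda,\mu)}\in\mathcal V$ be the unique solution of $$\int_\Omega 2\mu\,\hat\nabla u^{(k)}:\hat\nabla v+\lambda\,(\nabla\cdot u^{(k)})(\nabla\cdot v)\,dx=\int_{\Gamma_{\mathrm N}}g_k\cdot v\,ds\quad\text{for all }v\in\mathcal V$$ (the weak form of $\nabla\cdot(\lambda(\nabla\cdot u)I+2\mu\hat\nabla u)=0$ in $\Omega$, with traction $g_k$ on $\Gamma_{\mathrm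 N}^{(k)}$, zero traction on the rest of $\Gamma_{\mathrm N}$, and $u=0$ on $\Gamma_{\mathrm D}$). The discrete Neumann-to-Dirichlet matrix is the symmetric $M\times M$ matrix $\boldsymbol\Lambda(\lambda,\mu)=(\Lambda_l^{(k)}(\lambda,\mu))_{k,l=1,\dots,M}$ with $\Lambda_l^{(k)}(\lambda,\mu)=\int_{\Gamma_{\mathrm N}^{(l)}}g_l\cdot u^{(k)}\,ds$. Known constants. $\lambda_0,\mu_0>0$ (approximate background values), background errors $\epsilon^\lambda,\epsilon^\mu\ge0$, contrast bounds $c^\lambda,c^\mu>0$, noise level $\delta\ge0$. Set $(\lambda_{\mathcal{B}_{\min}},\mu_{\mathcal{B}_{\min}})=(\lambda_0(1-\epsilon^\lambda),\mu_0(1-\epsilon^\mu))$, $(\lambda_{\mathcal{B}_{\max}},\mu_{\mathcal{B}_{\max}})=(\lambda_0(1+\epsilon^\lambda),\mu_0(1+\epsilon^\mu))$, $(\lambda_{\mathcal{D}_{\max}},\mu_{\mathcal{D}_{\max}})=(\lambda_0-c^\lambda,\mu_0-c^\mu)$. It is assumed that $\lambda_{\mathcal{D}_{\max}},\mu_{\mathcal{D}_{\max}}>0$. Admissible data. These consist of a (measurable, unknown) inclusion $\mathcal D\subseteq\Omega$, Lamé parameters $\lambda,\mu\in L^\infty_+(\Omega)$ with $(\lambda,\mu)=(\lambda_{\mathcal D},\mu_{\mathcal D})$ on $\mathcal D$ and $(\lambda,\mu)=(\lambda_{\mathcal B},\mu_{\mathcal B})$ on $\Omega\setminus\mathcal D$,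 where $|\lambda_{\mathcal B}(x)-\lambda_0|\le\lambda_0\epsilon^\lambda$ and $|\mu_{\mathcal B}(x)-\mu_0|\le\mu_0\epsilon^\mu$ for all $x\in\Omega\setminus\mathcal D$, where $(\lambda_{\mathcal D},\mu_{\mathcal D})$ satisfies the contrast condition stated in the claim, and a noisy matrix $\boldsymbol\Lambda^\delta(\lambda,\mu)\in\mathbb R^{M\times M}$ with $\|\boldsymbol\Lambda(\lambda,\mu)-\boldsymbol\Lambda^\delta(\lambda,\mu)\|\le\delta$ (spectral norm). Conventions. For matrices, $A\le B$ means $x^TAx\le x^TBx$ for all $x\in\mathbb R^M$; inequalities between pairs of parameters are componentwise; $\mathrm{eig}[A]$ is the set of eigenvalues of $A$; $\mathbf I$ is the $M\times M$ identity matrix. Resolution guarantee. A method producing from the data a reconstruction $\mathcal D_R$ of $\mathcal D$ fulfills the resolution guarantee w.r.t. $(\omega_s)_{s=1,\dots,N}$ if for all admissible data: (i) $\omega_s\subseteq\mathcal D$ implies $\omega_s\subseteq\mathcal D_R$ for every $s\in\{1,\dots,N\}$; and (ii) $\mathcal D=\emptyset$ implies $\mathcal D_R=\emptyset$. *)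

(* Defs.v *)
From HB Require Import structures.
From mathcomp Require Import all_boot all_order all_algebra.
From mathcomp Require Import all_classical all_reals all_analysis.

Set Implicit Arguments.
Unset Strict Implicit.
Unset Printing Implicit Defensive.

Import Order.TTheory GRing.Theory Num.Theory.
Import numFieldNormedType.Exports.

Local Open Scope classical_set_scope.
Local Open Scope ring_scope.

Section euclidean.
Context {R : realType}.

(* The Frobenius product; it is the dot product on row and column vectors. *)
Definition frob {m n} (A B : 'M[R]_(m, n)) : R :=
  \sum_i \sum_j A i j * B i j.

(* The norm that the library puts on matrices is the sup norm. *)
Definition eucl {m n} (A : 'M[R]_(m, n)) : R := Num.sqrt (frob A A).

Definition spectral_norm {m} (A : 'M[R]_m) : R :=
  sup [set eucl (A *m x) | x in [set x : 'cV[R]_m | eucl x <= 1]].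

Definition qform {m} (A : 'M[R]_m) (x : 'cV[R]_m) : R := (x^T *m A *m x) 0 0.

(* A and B are not required to be symmetric. *)
Definition loewner_le {m} (A B : 'M[R]_m) : Prop :=
  forall x : 'cV[R]_m, qform A x <= qform B x.

Definition eig {m} (A : 'M[R]_m) : set R := [set a | eigenvalue A a].

End euclidean.

(* Any subset of T may occur in a cover: on this copy of T every set is
   measurable, so that the outer measure [mu_ext c] of the library is
   X |-> inf { \sum_k c (A_k) | X `<=` \bigcup_k A_k }, for A_k arbitrary. *)
Definition all_sets (T : Type) : Type := T.

HB.instance Definition _ (T : pointedType) := Pointed.on (all_sets T).
HB.instance Definition _ (T : pointedType) :=
  @isMeasurable.Build default_measure_display (all_sets T) setT
    I (fun _ _ => I) (fun _ _ => I).

Section lebesgue.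
Context {R : realType} (n : nat).
Local Open Scope ereal_scope.

Definition box (a b : 'rV[R]_n) : set 'rV[R]_n :=
  [set x | forall i, (a 0%R i <= x 0%R i < b 0%R i)%R].

Definition box_volume (a b : 'rV[R]_n) : R :=
  (\prod_i Num.max 0 (b 0 i - a 0 i))%R.

Definition box_cost (A : set 'rV[R]_n) : \bar R :=
  if A == set0 then 0
  else ereal_inf [set (box_volume ab.1 ab.2)%:E
                 | ab in [set ab | A `<=` box ab.1 ab.2]].

Lemma box_cost0 : box_cost set0 = 0.
Proof. by rewrite /box_cost eqxx. Qed.

Lemma box_cost_ge0 A : 0 <= box_cost A.
Proof.
rewrite /box_cost; case: ifP => // _.
apply: le_ereal_inf_tmp => _ [ab _ <-]; rewrite lee_fin.
by apply: prodr_ge0 => i _; rewrite le_max lexx.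
Qed.

Definition leb_outer : set 'rV[R]_n -> \bar R :=
  @mu_ext _ (all_sets 'rV[R]_n) R box_cost.

HB.instance Definition _ := isOuterMeasure.Build R 'rV[R]_n leb_outer
  (@mu_ext0 _ (all_sets 'rV[R]_n) R _ box_cost0 box_cost_ge0)
  (@mu_ext_ge0 _ (all_sets 'rV[R]_n) R _ box_cost_ge0)
  (@le_mu_ext _ (all_sets 'rV[R]_n) R box_cost)
  (@mu_ext_sigma_subadditive _ (all_sets 'rV[R]_n) R _ box_cost_ge0).

Definition leb_om : {outer_measure set 'rV[R]_n -> \bar R} := leb_outer.

(* Lebesgue measure, on the sigma-algebra of Lebesgue measurable sets. *)
Definition leb : {measure set (caratheodory_type leb_om) -> \bar R} := leb_om.

End lebesgue.
Arguments leb_outer R n : clear implicits.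
Arguments leb_om R n : clear implicits.
Arguments leb R n : clear implicits.

Section hausdorff.
Context {R : realType} (n s : nat).
Local Open Scope ereal_scope.

Definition diam (A : set 'rV[R]_n) : \bar R :=
  ereal_sup [set (eucl (p.1 - p.2)%R)%:E | p in A `*` A].

(* The factor makes H^s agree with the s-dimensional surface area. *)
Definition ball_volume : \bar R :=
  leb_outer R s [set x : 'rV[R]_s | (eucl x <= 1)%R].

Definition hausdorff_cost (r : R) (A : set 'rV[R]_n) : \bar R :=
  if A == set0 then 0
  else if diam A <= r%:E then ball_volume * (diam A * (2^-1)%:E) ^+ s
  else +oo.

Lemma hausdorff_cost0 r : hausdorff_cost r set0 = 0.
Proof. by rewrite /hausdorff_cost eqxx. Qed.

Lemma hausdorff_cost_ge0 r A : 0 <= hausdorff_cost r A.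
Proof.
rewrite /hausdorff_cost; case: ifPn => // /set0P[x Ax]; case: ifP => // _.
apply: mule_ge0; first exact: outer_measure_ge0.
apply: expe_ge0; apply: mule_ge0; last by rewrite lee_fin invr_ge0.
by apply: le_ereal_sup_tmp; exists 0 => //; exists (x, x) => //=;
  rewrite subrr /eucl /frob big1 ?sqrtr0// => i _;
  rewrite big1 // => j _; rewrite mxE mul0r.
Qed.

Definition hausdorff_pre (r : R) : set 'rV[R]_n -> \bar R :=
  @mu_ext _ (all_sets 'rV[R]_n) R (hausdorff_cost r).

Definition hausdorff_outer (X : set 'rV[R]_n) : \bar R :=
  ereal_sup [set hausdorff_pre r X | r in [set r | (0 < r)%R]].

Lemma hausdorff_outer_ge0 X : 0 <= hausdorff_outer X.
Proof.
apply: le_ereal_sup_tmp; exists (hausdorff_pre 1 X); first by exists 1%R => /=.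
exact: (@mu_ext_ge0 _ (all_sets 'rV[R]_n) R _ (hausdorff_cost_ge0 1)).
Qed.

Lemma hausdorff_outer0 : hausdorff_outer set0 = 0.
Proof.
apply/eqP; rewrite eq_le hausdorff_outer_ge0 andbT.
apply: ge_ereal_sup => _ [r _ <-]; rewrite /hausdorff_pre.
by rewrite (@mu_ext0 _ (all_sets 'rV[R]_n) R _ (hausdorff_cost0 r)
  (hausdorff_cost_ge0 r)).
Qed.

Lemma le_hausdorff_outer : {homo hausdorff_outer : A B / A `<=` B >-> A <= B}.
Proof.
move=> A B AB; apply: ge_ereal_sup => _ [r r0 <-].
apply: le_ereal_sup_tmp; exists (hausdorff_pre r B); first by exists r.
exact: (@le_mu_ext _ (all_sets 'rV[R]_n) R).
Qed.

Lemma hausdorff_outer_sigma_subadditive : sigma_subadditive hausdorff_outer.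
Proof.
move=> F; apply: ge_ereal_sup => _ [r r0 <-].
apply: (le_trans (@mu_ext_sigma_subadditive _ (all_sets 'rV[R]_n) R _
  (hausdorff_cost_ge0 r) F)).
apply: lee_nneseries => [i _ _|i _].
  exact: (@mu_ext_ge0 _ (all_sets 'rV[R]_n) R _ (hausdorff_cost_ge0 r)).
by apply: le_ereal_sup_tmp; exists (hausdorff_pre r (F i)) => //; exists r.
Qed.

HB.instance Definition _ := isOuterMeasure.Build R 'rV[R]_n hausdorff_outer
  hausdorff_outer0 hausdorff_outer_ge0 le_hausdorff_outer
  hausdorff_outer_sigma_subadditive.

Definition hausdorff_om : {outer_measure set 'rV[R]_n -> \bar R} :=
  hausdorff_outer.

Definition hausdorff :
    {measure set (caratheodory_type hausdorff_om) -> \bar R} := hausdorff_om.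

End hausdorff.
Arguments hausdorff_om R n s : clear implicits.
Arguments hausdorff R n s : clear implicits.

(* The surface measure ds on hypersurfaces of R^d. *)
Notation surf R d := (hausdorff R d d.-1).

Section domains.
Context {R : realType}.

Definition bnd {T : topologicalType} (A : set T) : set T :=
  closure A `\` interior A.

Definition rel_open {T : topologicalType} (X A : set T) : Prop :=
  exists2 U : set T, open U & A = X `&` U.

Definition partial {n} (i : 'I_n) (f : 'rV[R]_n -> R) : 'rV[R]_n -> R :=
  fun x => 'D_(delta_mx 0 i) f x.

Fixpoint Ck {n} (k : nat) (f : 'rV[R]_n -> R) : Prop :=
  continuous f /\
  if k is k'.+1 then
    forall i, (forall x, derivable f x (delta_mx 0 i)) /\ Ck k' (partial i f)
  else True.

Definition smooth {n} (f : 'rV[R]_n -> R) : Prop := forall k, Ck k f.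

Definition orthogonal_mx {n} (Q : 'M[R]_n) : Prop := Q *m Q^T = 1%:M.

(* In the coordinates y = x *m Q, the i-th coordinate y 0 i is compared with
   a function of the remaining coordinates col' i y. *)
Definition lipschitz_domain {d} (Omega : set 'rV[R]_d) : Prop :=
  forall x0, bnd Omega x0 ->
  exists (Q : 'M[R]_d) (i : 'I_d) (h : 'rV[R]_d.-1 -> R) (k : R),
    [/\ orthogonal_mx Q, k.-lipschitz h &
        \forall x \near x0,
          Omega x <-> h (col' i (x *m Q)) < (x *m Q) 0 i].

Definition smooth_hypersurface {d} (S : set 'rV[R]_d) : Prop :=
  forall x0, S x0 ->
  exists (Q : 'M[R]_d) (i : 'I_d) (h : 'rV[R]_d.-1 -> R),
    [/\ orthogonal_mx Q, smooth h &
        \forall x \near x0,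
          S x <-> (x *m Q) 0 i = h (col' i (x *m Q))].

(* Smoothness up to the edges of the pieces is not required. *)
Definition piecewise_smooth {d} (B : set 'rV[R]_d) : Prop :=
  exists (m : nat) (S : 'I_m -> set 'rV[R]_d),
    [/\ trivIset setT S,
        forall j, rel_open B (S j) /\ smooth_hypersurface (S j),
        B = closure (\bigcup_j S j) &
        surf R d (B `\` \bigcup_j S j) = 0%E].

End domains.

Section sobolev.
Context {R : realType} {d : nat}.
Implicit Types (Omega : set 'rV[R]_d) (f p t : 'rV[R]_d -> R).

Definition L2 Omega f : Prop := f \_ Omega \in Lfun (leb R d) 2%:E.

Definition L2surf (B : set 'rV[R]_d) f : Prop :=
  f \_ B \in Lfun (surf R d) 2%:E.

Definition Linfty_pos Omega f : Prop :=
  f \_ Omega \in Lfun (leb R d) +oo%E /\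
  exists2 c : R, 0 < c & {ae leb R d, forall x, Omega x -> c <= f x}.

Definition test_function Omega f : Prop :=
  smooth f /\
  exists K : set 'rV[R]_d,
    [/\ compact K, K `<=` Omega & forall x, ~ K x -> f x = 0].

Definition is_weak_partial Omega (i : 'I_d) f p : Prop :=
  L2 Omega p /\
  forall phi, test_function Omega phi ->
    \int[leb R d]_(x in Omega) (f x * partial i phi x) =
    - \int[leb R d]_(x in Omega) (p x * phi x).

Definition H1 Omega f : Prop :=
  L2 Omega f /\ forall i, exists p, is_weak_partial Omega i f p.

(* Weak derivatives and traces are unique only almost everywhere:
   [weak_partial] and [trace] pick a representative, which is meaningful only
   for f in H^1(Omega). *)
Definition weak_partial Omega (i : 'I_d) f : 'rV[R]_d -> R :=
  xget (cst 0) [set p | is_weak_partial Omega i f p].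

(* The trace operator is the continuous extension to H^1(Omega), with values
   in L^2(bnd Omega), of the restriction to the boundary of functions that are
   smooth up to the boundary (these are dense in H^1(Omega) for a bounded
   Lipschitz domain). *)
Definition is_trace Omega f t : Prop :=
  L2surf (bnd Omega) t /\
  exists phi : nat -> 'rV[R]_d -> R,
  [/\ forall m, smooth (phi m),
      (\int[leb R d]_(x in Omega) ((phi m x - f x) ^+ 2)%:E @[m --> \oo]
         --> 0)%E,
      forall i, (\int[leb R d]_(x in Omega)
          ((partial i (phi m) x - weak_partial Omega i f x) ^+ 2)%:E
            @[m --> \oo] --> 0)%E &
      (\int[surf R d]_(x in bnd Omega) ((phi m x - t x) ^+ 2)%:E @[m --> \oo]
         --> 0)%E].

Definition trace Omega f : 'rV[R]_d -> R :=
  xget (cst 0) [set t | is_trace Omega f t].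

End sobolev.

Section elasticity.
Context {R : realType} {d : nat}.
Implicit Types (Omega GD GN : set 'rV[R]_d) (u v g : 'rV[R]_d -> 'rV[R]_d).
Implicit Types (lam mu : 'rV[R]_d -> R).

Definition component u (i : 'I_d) : 'rV[R]_d -> R := fun x => u x 0 i.

Definition jac Omega u (x : 'rV[R]_d) : 'M[R]_d :=
  \matrix_(i, j) weak_partial Omega j (component u i) x.

Definition strain Omega u (x : 'rV[R]_d) : 'M[R]_d :=
  2^-1 *: (jac Omega u x + (jac Omega u x)^T).

Definition div Omega u (x : 'rV[R]_d) : R := \tr (jac Omega u x).

Definition vtrace Omega u (x : 'rV[R]_d) : 'rV[R]_d :=
  \row_i trace Omega (component u i) x.

Definition in_V Omega GD v : Prop :=
  (forall i, H1 Omega (component v i)) /\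
  {ae surf R d, forall x, GD x -> vtrace Omega v x = 0}.

Definition weak_solution Omega GD GN lam mu g u : Prop :=
  in_V Omega GD u /\
  forall v, in_V Omega GD v ->
    \int[leb R d]_(x in Omega)
      (2 * mu x * frob (strain Omega u x) (strain Omega v x)
       + lam x * (div Omega u x * div Omega v x)) =
    \int[surf R d]_(x in GN) frob (g x) (vtrace Omega v x).

Definition unique_weak_solution Omega GD GN lam mu g u : Prop :=
  weak_solution Omega GD GN lam mu g u /\
  forall w, weak_solution Omega GD GN lam mu g w ->
    {ae leb R d, forall x, Omega x -> w x = u x}.

Definition elastic_domain Omega GD GN : Prop :=
  [/\ [/\ bounded_set Omega, connected Omega & open Omega],
      lipschitz_domain Omega,
      piecewise_smooth (bnd Omega),
      bnd Omega = closure (GD `|` GN) /\ GD `&` GN = set0 &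
      [/\ GD !=set0, rel_open (bnd Omega) GD & connected GD] /\
      [/\ GN !=set0, rel_open (bnd Omega) GN & connected GN]].

Definition resolution_partition {N} Omega (omega : 'I_N -> set 'rV[R]_d) :
    Prop :=
  [/\ forall s, open (omega s) /\ omega s `<=` Omega,
      trivIset setT omega &
      closure Omega = \bigcup_s closure (omega s)].

Definition boundary_loads {M} GN (G : 'I_M -> set 'rV[R]_d)
    (g : 'I_M -> 'rV[R]_d -> 'rV[R]_d) : Prop :=
  [/\ forall l, G l `<=` GN /\
        (hausdorff_om R d d.-1).-cara.-measurable (G l),
      trivIset setT G,
      forall l i, L2surf GN (component (g l) i) &
      forall l, {ae surf R d, forall x, GN x -> ~ G l x -> g l x = 0}].

(* The (k, l) entry is the integral over the patch l of g_l . u^(k). *)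
Definition ntd {M} Omega (G : 'I_M -> set 'rV[R]_d)
    (g u : 'I_M -> 'rV[R]_d -> 'rV[R]_d) : 'M[R]_M :=
  \matrix_(k, l)
    \int[surf R d]_(x in G l) frob (g l x) (vtrace Omega (u k) x).

End elasticity.

Record constants (R : realType) := Constants {
  lam0 : R; mu0 : R;
  eps_lam : R; eps_mu : R;
  c_lam : R; c_mu : R;
  delta : R }.

Section reconstruction.
Context {R : realType} {d N M : nat}.
Variables (Omega : set 'rV[R]_d) (omega : 'I_N -> set 'rV[R]_d).
Variable c : constants R.
(* The Neumann-to-Dirichlet matrix as a function of (lambda, mu). *)
Variable Lambda : ('rV[R]_d -> R) -> ('rV[R]_d -> R) -> 'M[R]_M.

Definition lamB_min : R := lam0 c * (1 - eps_lam c).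
Definition muB_min : R := mu0 c * (1 - eps_mu c).
Definition lamB_max : R := lam0 c * (1 + eps_lam c).
Definition muB_max : R := mu0 c * (1 + eps_mu c).
Definition lamD_max : R := lam0 c - c_lam c.
Definition muD_max : R := mu0 c - c_mu c.

Definition valid_constants : Prop :=
  [/\ 0 < lam0 c /\ 0 < mu0 c,
      0 <= eps_lam c /\ 0 <= eps_mu c,
      0 < c_lam c /\ 0 < c_mu c,
      0 <= delta c &
      0 < lamD_max /\ 0 < muD_max].

Definition weak_inclusion : Prop := lamD_max < lamB_min /\ muD_max < muB_min.

Definition admissible (D : set 'rV[R]_d) (Lambda_noisy : 'M[R]_M) : Prop :=
  D `<=` Omega /\ (leb_om R d).-cara.-measurable D /\
  exists lam mu lamB muB lamD muD : 'rV[R]_d -> R,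
  [/\ Linfty_pos Omega lam /\ Linfty_pos Omega mu,
      forall x, D x -> lam x = lamD x /\ mu x = muD x,
      forall x, (Omega `\` D) x -> lam x = lamB x /\ mu x = muB x,
      forall x, (Omega `\` D) x ->
        `|lamB x - lam0 c| <= lam0 c * eps_lam c /\
        `|muB x - mu0 c| <= mu0 c * eps_mu c &
      (forall x, D x ->
        c_lam c <= lam0 c - lamD x /\ c_mu c <= mu0 c - muD x) /\
      spectral_norm (Lambda lam mu - Lambda_noisy) <= delta c].

Definition tau (a b : R) (s : 'I_N) (x : 'rV[R]_d) : R :=
  a * \1_(Omega `\` omega s) x + b * \1_(omega s) x.

Definition Lambda_tau (s : 'I_N) : 'M[R]_M :=
  Lambda (tau lamB_max lamD_max s) (tau muB_max muD_max s).

Definition marked (Lambda_noisy : 'M[R]_M) (s : 'I_N) : Prop :=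
  loewner_le (Lambda_tau s - (delta c)%:M) Lambda_noisy.

Definition reconstruct (Lambda_noisy : 'M[R]_M) : set 'rV[R]_d :=
  \bigcup_(s in [set s | marked Lambda_noisy s]) omega s.

(* The suprema and the infimum are over finite sets, hence attained unless
   M = 0 or N = 0, in which case nu = 0. *)
Definition nu : R :=
  inf (range (fun s : 'I_N =>
    sup (eig (Lambda_tau s - Lambda (cst lamB_min) (cst muB_min))))).

(* The method sees the noisy matrix, but neither D nor (lambda, mu). *)
Definition resolution_guarantee (method : 'M[R]_M -> set 'rV[R]_d) : Prop :=
  forall (D : set 'rV[R]_d) (Lambda_noisy : 'M[R]_M),
    admissible D Lambda_noisy ->
    (forall s, omega s `<=` D -> omega s `<=` method Lambda_noisy) /\
    (D = set0 -> method Lambda_noisy = set0).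

End reconstruction.

(* Main.v *)
Require Import Defs.
From HB Require Import structures.
From mathcomp Require Import all_boot all_order all_algebra.
From mathcomp Require Import all_classical all_reals all_analysis.
From mathcomp Require Import ess_sup_inf measurable_realfun.
From mathcomp Require Import ring lra.

Set Implicit Arguments.
Unset Strict Implicit.
Unset Printing Implicit Defensive.

Import Order.TTheory GRing.Theory Num.Theory.
Import numFieldNormedType.Exports.

Local Open Scope classical_set_scope.
Local Open Scope ring_scope.

(** The method is correct because the Neumann-to-Dirichlet matrix is monotone:
    if the moduli (lam', mu') are at least (lam, mu) on Omega, then
    Lambda(lam', mu') <= Lambda(lam, mu) ([ntd_loewner_le]).

    If omega_s lies in D, the true moduli are at most tau_s everywhere, so
    Lambda(tau_s) <= Lambda(lam, mu); noise of spectral norm at most delta is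
    absorbed by the shift -delta I, and omega_s is marked
    ([loewner_le_noisy]).  If D is empty, the true moduli are at least the
    minimal background, so Lambda(lam, mu) <= Lambda(B_min); if some omega_s
    were marked, then Lambda(tau_s) - Lambda(B_min) <= 2 delta I and nu would
    be at most 2 delta ([sup_eig_noisy]).

    Monotonicity comes from testing the two weak formulations with each
    other's solutions.  Let a, a' be the energy forms of the two materials, u_k
    and u'_k the displacements under the k-th load.  The measurement of a
    displacement v on the l-th patch is the load functional of g_l at v, hence
    equals a(u_l, v) and a'(u'_l, v) ([patch_integral_energy]).  Therefore
    Lambda_kl = a(u_l, u_k) and Lambda'_kl = a(u_l, u'_k) = a'(u'_l, u'_k), and
    the conclusion follows from a <= a' and from 0 <= a(E - E', E - E') for the
    superpositions E, E' of the two families of displacement gradients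
    ([energy_loewner_le]).  These superpositions are formed pointwise from
    chosen representatives of the weak gradients, so that the argument rests on
    the algebra of the energy density, a positive bilinear form at each point.

    The measure theory consists of two facts: open sets are Lebesgue measurable
    for the outer measure defined by boxes ([open_measurable_leb]), which makes
    the moduli tau_s essentially bounded and positive, and a bounded function
    times two square integrable ones is integrable
    ([integrable_weighted_product]). *)

(** * Quadratic forms, spectral norm and noise *)

Section frobenius.
Context {R : realType} {m n : nat}.
Implicit Types (A B C : 'M[R]_(m, n)) (a : R).

Lemma frobC A B : frob A B = frob B A.
Proof. by do 2 (apply: eq_bigr => ? _); rewrite mulrC. Qed.

Lemma frobDl A B C : frob (A + B) C = frob A C + frob B C.
Proof.
rewrite /frob -big_split; apply: eq_bigr => i _; rewrite -big_split.
by apply: eq_bigr => j _; rewrite !mxE mulrDl.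
Qed.

Lemma frobZl a A B : frob (a *: A) B = a * frob A B.
Proof.
rewrite /frob mulr_sumr; apply: eq_bigr => i _; rewrite mulr_sumr.
by apply: eq_bigr => j _; rewrite !mxE mulrA.
Qed.

Lemma frob_ge0 A : 0 <= frob A A.
Proof. by do 2 (apply: sumr_ge0 => ? _); rewrite -expr2 sqr_ge0. Qed.

Lemma frob_eq0 A : (frob A A == 0) = (A == 0).
Proof.
apply/eqP/eqP => [/eqP|->]; last first.
  by rewrite /frob big1// => i _; rewrite big1// => j _; rewrite mxE mul0r.
rewrite psumr_eq0 => [/allP A0|i _]; last first.
  by apply: sumr_ge0 => j _; rewrite -expr2 sqr_ge0.
apply/matrixP => i j; have := A0 i; rewrite mem_index_enum => /(_ isT).
rewrite psumr_eq0 => [/allP/(_ j)|k _]; last by rewrite -expr2 sqr_ge0.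
by rewrite mem_index_enum mulf_eq0 orbb mxE => /(_ isT)/eqP.
Qed.

Lemma frob_CauchySchwarz A B : frob A B ^+ 2 <= frob A A * frob B B.
Proof.
have [/eqP|B0] := eqVneq (frob B B) 0.
  rewrite frob_eq0 => /eqP ->; rewrite frobC -(scale0r 0) !frobZl.
  by rewrite !mul0r expr0n mulr0.
have Bgt0 : 0 < frob B B by rewrite lt_def B0 frob_ge0.
rewrite -subr_ge0 -(pmulr_rge0 _ Bgt0).
(* This is the square norm of a multiple of the part of A orthogonal to B. *)
have := frob_ge0 (frob B B *: A + (- frob A B) *: B).
rewrite frobDl !frobZl !(frobC _ (_ + _)) !frobDl !frobZl (frobC B A).
by congr (_ <= _); ring.
Qed.

End frobenius.

Section quadratic_forms.
Context {R : realType} {m : nat}.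
Implicit Types (A B : 'M[R]_m) (x : 'cV[R]_m).

Lemma qformE A x : qform A x = frob x (A *m x).
Proof.
rewrite /qform -mulmxA mxE; apply: eq_bigr => i _.
by rewrite big_ord1 mxE.
Qed.

Lemma qformB A B x : qform (A - B) x = qform A x - qform B x.
Proof. by rewrite /qform mulmxBr mulmxBl !mxE. Qed.

Lemma qform_scalar (a : R) x : qform a%:M x = a * frob x x.
Proof. by rewrite qformE mul_scalar_mx frobC frobZl. Qed.

Lemma frob_mulmx A x : frob (A *m x) (A *m x) <= frob A A * frob x x.
Proof.
rewrite {1 2}/frob mulr_suml; apply: ler_sum => i _; rewrite big_ord1 -expr2.
have -> : (A *m x) i 0 = frob (row i A) x^T.
  by rewrite mxE /frob big_ord1; apply: eq_bigr => j _; rewrite !mxE.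
have -> : frob x x = frob x^T x^T.
  by rewrite /frob exchange_big; do 2 (apply: eq_bigr => ? _); rewrite !mxE.
apply: (le_trans (frob_CauchySchwarz _ _)); rewrite ler_wpM2r ?frob_ge0//.
by rewrite /frob big_ord1 le_eqVlt; apply/orP; left; apply/eqP;
  apply: eq_bigr => j _; rewrite !mxE.
Qed.

Lemma euclZ {p q} (a : R) (y : 'M[R]_(p, q)) : eucl (a *: y) = `|a| * eucl y.
Proof.
by rewrite /eucl frobZl frobC frobZl mulrA -expr2 sqrtrM ?sqr_ge0// sqrtr_sqr.
Qed.

(** The Frobenius norm bounds the set whose supremum defines the spectral
    norm, so that this supremum really is an operator norm. *)
Lemma eucl_mulmx_le A x : eucl (A *m x) <= spectral_norm A * eucl x.
Proof.
have hub (y : 'cV[R]_m) : eucl y <= 1 -> eucl (A *m y) <= spectral_norm A.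
  move=> y1; apply: ub_le_sup; last by exists y.
  exists (eucl A) => _ [z /= z1 <-].
  apply: (@le_trans _ _ (eucl A * eucl z)); last first.
    by rewrite ler_piMr ?sqrtr_ge0.
  by rewrite /eucl -sqrtrM ?frob_ge0// ler_wsqrtr// frob_mulmx.
have [x0|x0] := eqVneq (eucl x) 0.
  have : frob x x == 0.
    by rewrite eq_le frob_ge0 andbT -sqrtr_eq0 -/(eucl x) x0.
  rewrite frob_eq0 x0 mulr0 => /eqP ->.
  by rewrite mulmx0 -(scale0r 0) euclZ normr0 mul0r.
have xgt0 : 0 < eucl x by rewrite lt_def x0 sqrtr_ge0.
have := hub ((eucl x)^-1 *: x).
rewrite -scalemxAr !euclZ ger0_norm ?invr_ge0 ?(ltW xgt0)//.
by rewrite mulVf// lexx => /(_ isT); rewrite mulrC ler_pdivrMr.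
Qed.

Lemma norm_qform_le A x : `|qform A x| <= spectral_norm A * frob x x.
Proof.
rewrite qformE; apply: (@le_trans _ _ (eucl x * eucl (A *m x))).
  rewrite /eucl -sqrtrM ?frob_ge0// -sqrtr_sqr ler_wsqrtr//.
  exact: frob_CauchySchwarz.
have -> : frob x x = eucl x * eucl x by rewrite -expr2 sqr_sqrtr ?frob_ge0.
rewrite mulrA mulrAC mulrC ler_wpM2r ?sqrtr_ge0//.
exact: eucl_mulmx_le.
Qed.

Lemma eig_le A (b a : R) :
  (forall x, qform A x <= b * frob x x) -> eig A a -> a <= b.
Proof.
move=> Ab /eigenvalueP[v vA v0].
have frobv : frob v^T v^T = frob v v.
  by rewrite /frob exchange_big; do 2 (apply: eq_bigr => ? _); rewrite !mxE.
have vgt0 : 0 < frob v v by rewrite lt_def frob_eq0 v0 frob_ge0.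
rewrite -(ler_pM2r vgt0).
have <- : qform A v^T = a * frob v v.
  rewrite /qform trmxK vA -scalemxAl !mxE /frob big_ord1; congr (_ * _).
  by apply: eq_bigr => j _; rewrite !mxE.
by rewrite -frobv.
Qed.

Lemma qform_noise A N (delta : R) x : spectral_norm (A - N) <= delta ->
  `|qform A x - qform N x| <= delta * frob x x.
Proof.
move=> AN; rewrite -qformB (le_trans (norm_qform_le _ _))//.
by rewrite ler_wpM2r// frob_ge0.
Qed.

(** The test matrix A is shifted by the noise level so that noise cannot make
    a true inequality fail. *)
Lemma loewner_le_noisy A B N (delta : R) :
  loewner_le A B -> spectral_norm (B - N) <= delta ->
  loewner_le (A - delta%:M) N.
Proof.
move=> AB BN x; rewrite qformB qform_scalar.
have := AB x; have := qform_noise x BN.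
by rewrite ler_norml => /andP[_]; lra.
Qed.

(** Conversely, a test passed in spite of B <= C bounds A - C by twice the
    noise level, once for the shift and once for the noise. *)
Lemma sup_eig_noisy A B C N (delta : R) : 0 <= delta ->
  loewner_le (A - delta%:M) N -> spectral_norm (B - N) <= delta ->
  loewner_le B C -> sup (eig (A - C)) <= 2 * delta.
Proof.
move=> delta0 AN BN BC.
(* For m = 0 there is no eigenvalue, and the supremum is 0. *)
have [->|/set0P E0] := eqVneq (eig (A - C)) set0.
  by rewrite sup0 mulr_ge0.
apply: ge_sup => // a; apply: eig_le => x.
have := AN x; rewrite !qformB qform_scalar; have := BC x.
have := qform_noise x BN; rewrite ler_norml => /andP[+ _].
by rewrite -mulrA; lra.
Qed.

End quadratic_forms.

(** * Open sets are Lebesgue measurable *)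

Section open_sets_measurable.
Context {R : realType} {n : nat}.
Implicit Types (A U : set 'rV[R]_n) (a b x : 'rV[R]_n).

Lemma box_cost_le A a b :
  A `<=` box a b -> (box_cost A <= (box_volume a b)%:E)%E.
Proof.
move=> Aab; rewrite /box_cost; case: ifP => _; last first.
  by apply: ereal_inf_lbound; exists (a, b).
by rewrite lee_fin; apply: prodr_ge0 => i _; rewrite le_max lexx.
Qed.

Definition half_space (i : 'I_n) (c : R) : set 'rV[R]_n := [set x | x 0 i < c].

(** A coordinate hyperplane cuts a box into two boxes, whose volumes add up:
    the volumes agree in all factors but the one of that coordinate. *)
Lemma box_cost_split A i c :
  (box_cost (A `&` half_space i c) + box_cost (A `&` ~` half_space i c)
    <= box_cost A)%E.
Proof.
have [->|A0] := eqVneq A set0; first by rewrite !set0I !box_cost0 adde0.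
rewrite [leRHS]/box_cost (negPf A0).
apply: le_ereal_inf_tmp => _ [[a b] /= Aab <-].
pose b' := \row_j (if j == i then Num.min (b 0 i) c else b 0 j).
pose a' := \row_j (if j == i then Num.max (a 0 i) c else a 0 j).
have -> : box_volume a b = box_volume a b' + box_volume a' b.
  have volD p q : box_volume p q = Num.max 0 (q 0 i - p 0 i) *
      \prod_(j | j != i) Num.max 0 (q 0 j - p 0 j) by exact: bigD1.
  have volb' : \prod_(j | j != i) Num.max 0 (b' 0 j - a 0 j) =
      \prod_(j | j != i) Num.max 0 (b 0 j - a 0 j).
    by apply: eq_bigr => j /negPf ji; rewrite mxE ji.
  have vola' : \prod_(j | j != i) Num.max 0 (b 0 j - a' 0 j) =
      \prod_(j | j != i) Num.max 0 (b 0 j - a 0 j).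
    by apply: eq_bigr => j /negPf ji; rewrite mxE ji.
  rewrite !volD volb' vola' !mxE eqxx.
  rewrite -mulrDl; congr (_ * _).
  (* What remains is the additivity of length for a side cut at c. *)
  have [bc|cb] := ltP (b 0 i) c; have [ac|ca] := ltP (a 0 i) c;
    rewrite /Num.max; do ![case: ltP => ?]; lra.
rewrite EFinD; apply: leeD; apply: box_cost_le => x [/Aab xab].
  move=> xc j; rewrite !mxE; case: eqP => [->|_]; last exact: xab.
  by have /andP[-> xb] := xab i; rewrite lt_min xb xc.
move=> /negP; rewrite -leNgt => xc j; rewrite !mxE.
case: eqP => [->|_]; last exact: xab.
by have /andP[ax ->] := xab i; rewrite ge_max ax xc.
Qed.

Lemma measurable_half_space i c :
  (leb_om R n).-cara.-measurable (half_space i c).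
Proof.
apply: le_caratheodory_measurable => X.
apply: le_ereal_inf_tmp => _ [F [_ XF] <-].
apply: (@le_trans _ _ (\sum_(k <oo) (box_cost (F k `&` half_space i c) +
    box_cost (F k `&` ~` half_space i c)))%E); last first.
  apply: lee_nneseries => k *; last exact: box_cost_split.
  exact: adde_ge0 (box_cost_ge0 _) (box_cost_ge0 _).
rewrite nneseriesD; try by move=> *; exact: box_cost_ge0.
apply: leeD; apply: ereal_inf_lbound.
  exists (fun k => F k `&` half_space i c) => //; split => //.
  by rewrite -setI_bigcupl; exact: setSI.
exists (fun k => F k `&` ~` half_space i c) => //; split => //.
by rewrite -setI_bigcupl; exact: setSI.
Qed.

Lemma measurable_box a b : (leb_om R n).-cara.-measurable (box a b).
Proof.
rewrite (_ : box a b = \bigcap_(i in [set: 'I_n])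
    (half_space i (b 0 i) `&` ~` half_space i (a 0 i))); last first.
  apply/seteqP; split => x /= xab i; [move=> _|].
    by have /andP[ax xb] := xab i; split=> //; apply/negP; rewrite -leNgt.
  by have [/= -> /negP] := xab i I; rewrite -leNgt => ->.
apply: fin_bigcap_measurable => [|i _]; first exact: finite_finset.
by apply: measurableI; [|apply: measurableC]; exact: measurable_half_space.
Qed.

(** Boxes with rational corners form a countable base of the topology. *)
Lemma open_measurable_leb U : open U -> (leb_om R n).-cara.-measurable U.
Proof.
move=> oU.
pose rbox (q : 'rV[rat]_n * 'rV[rat]_n) : set 'rV[R]_n :=
  box (map_mx ratr q.1) (map_mx ratr q.2).
pose B q := if `[< rbox q `<=` U >] then rbox q else set0.
have -> : U = \bigcup_q B q.
  apply/seteqP; split => [x Ux|x [q _]]; last first.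
    by rewrite /B; case: asboolP => // qU /qU.
  have /nbhs_ballP[e /= e0 xeU] := open_nbhs_nbhs (conj oU Ux).
  have aP i : {q : rat | ratr q \in `]x 0 i - e, x 0 i[}.
    by apply: cid; apply: rat_in_itvoo; rewrite gtrBl.
  have bP i : {q : rat | ratr q \in `]x 0 i, x 0 i + e[}.
    by apply: cid; apply: rat_in_itvoo; rewrite ltrDl.
  pose q := (\row_i sval (aP i), \row_i sval (bP i)).
  exists q => //; rewrite /B; case: asboolP => [_|].
    move=> i; rewrite !mxE; case: (aP i) => /= a; case: (bP i) => /= b.
    by rewrite !in_itv/= => /andP[xb _] /andP[_ /ltW ->].
  case; apply: subset_trans xeU => y yq; split => // i j; rewrite ord1.
  have := yq j; rewrite !mxE; case: (aP j) => /= a; case: (bP j) => /= b.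
  rewrite !in_itv/= /ball/= ltr_norml.
  by move=> /andP[_ b1] /andP[a1 _] /andP[ay yb]; apply/andP; split; lra.
apply: countable_bigcupT_measurable => [|q]; first exact: countableP.
by rewrite /B; case: ifP => _; [exact: measurable_box|exact: measurable0].
Qed.

End open_sets_measurable.

(** * Integrability of weighted products *)

Section weighted_products.
Context {disp} {T : measurableType disp} {R : realType}.
Context {m : {measure set T -> \bar R}} {D : set T}.
Implicit Types f g a : T -> R.

Definition L2on f := f \_ D \in Lfun m 2%:E.
Definition Linfon a := a \_ D \in Lfun m +oo%E.

Let one_le2 : (1%E <= 2%:E :> \bar R)%E.
Proof. by rewrite lee_fin ler1n. Qed.

Lemma L2onD f g : L2on f -> L2on g -> L2on (f \+ g).
Proof.
move=> f2 g2; rewrite /L2on (_ : _ \_ D = f \_ D + g \_ D).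
  exact: (Lfun_addr_closed m one_le2).2.
apply/funext => x; rewrite /GRing.add/= !patchE.
by case: ifP => //; rewrite addr0.
Qed.

Lemma L2on0 : L2on (cst 0).
Proof.
rewrite /L2on (_ : _ \_ D = 0); first exact: (Lfun_addr_closed m one_le2).1.
by apply/funext => x; rewrite patchE; case: ifP.
Qed.

Lemma L2onZ (c : R) f : L2on f -> L2on (fun x => c * f x).
Proof.
move=> f2; rewrite /L2on (_ : _ \_ D = c *: (f \_ D) + 0).
  apply: (Lfun_submod_closed m one_le2).2 => //.
  exact: (Lfun_submod_closed m one_le2).1.
apply/funext => x; rewrite addr0 /GRing.scale/= !patchE.
by case: ifP => // _; exact/esym/mulr0.
Qed.

Lemma L2on_sum I (r : seq I) (F : I -> T -> R) :
  (forall i, L2on (F i)) -> L2on (fun x => \sum_(i <- r) F i x).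
Proof.
move=> F2; elim: r => [|i r ih].
  by under eq_fun do rewrite big_nil; exact: L2on0.
by under eq_fun do rewrite big_cons; exact: L2onD.
Qed.

Lemma Lfun_infty_ae_bounded a :
  a \in Lfun m +oo%E -> exists C, {ae m, forall x, `|a x| <= C}.
Proof.
move=> /andP[_]; rewrite inE /= /finite_norm unlock; case: ifPn => [_|].
  have := ess_sup_ge m (abse \o (EFin \o a)).
  case: (ess_sup _ _) => [C aC _|//|aC _].
    by exists C; apply: filterS aC => x /=; rewrite lee_fin.
  by exists 0; apply: filterS aC => x.
(* The essential norm for the null measure is 0 by convention, but then every
   bound holds almost everywhere. *)
rewrite -leNgt => m0 _; exists 0; exists setT; split => //.
by apply/eqP; rewrite eq_le m0 measure_ge0.
Qed.

(** The product of two square integrable functions and a bounded one is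
    integrable: the only source of integrability in what follows. *)
Lemma integrable_weighted_product a f g : measurable D ->
  Linfon a -> L2on f -> L2on g ->
  m.-integrable D (EFin \o (fun x => a x * (f x * g x))).
Proof.
move=> mD aoo f2 g2; apply/(integrable_mkcond _ mD).
rewrite restrict_EFin.
have -> : (fun x => a x * (f x * g x)) \_ D =
    (fun x => (a \_ D) x * ((f \_ D) x * (g \_ D) x)).
  by apply/funext => x; rewrite !patchE; case: ifP => //; rewrite mul0r.
have [C aC] := Lfun_infty_ae_bounded aoo.
have /Lfun1_integrable fg1 := Lfun2_mul_Lfun1 f2 g2.
have ma : measurable_fun setT (a \_ D).
  by move: aoo => /andP[+ _]; rewrite inE.
have mfg : measurable_fun setT (fun x => (f \_ D) x * (g \_ D) x).
  exact/measurable_EFinP/(measurable_int _ fg1).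
apply/integrableP; split; first exact/measurable_EFinP/measurable_funM.
have /integrableP[_] := integrableZl measurableT C fg1.
apply: le_lt_trans; apply: ae_ge0_le_integral => //.
- exact/measurableT_comp/measurable_EFinP/measurable_funM.
- by apply: measurableT_comp => //; apply/measurable_EFinP/measurable_funM.
apply: filterS aC => x aC _ /=; rewrite lee_fin !normrM.
by rewrite ler_wpM2r ?mulr_ge0// (le_trans aC) ?ler_norm.
Qed.

Lemma bounded_Linfon a (C : R) : measurable D -> measurable_fun D a ->
  (forall x, D x -> `|a x| <= C) -> Linfon a.
Proof.
move=> mD ma aC; apply/andP; split; rewrite inE /=.
  exact/(measurable_restrictT a mD).
rewrite /finite_norm unlock; case: ifP => // _.
apply: (@le_lt_trans _ _ (Num.max C 0)%:E); last exact: ltry.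
apply/ess_supP/nearW => x /=; rewrite lee_fin patchE le_max.
by case: ifPn => [/set_mem/aC ->//|_]; rewrite normr0 lexx orbT.
Qed.

Lemma ae_pos_ge0 a :
  (exists2 c : R, 0 < c & {ae m, forall x, D x -> c <= a x}) ->
  {ae m, forall x, D x -> 0 <= a x}.
Proof. by move=> [c c0]; apply: filterS => x ca /ca; exact/le_trans/ltW. Qed.

End weighted_products.
Arguments L2on {disp T R} m D f.
Arguments Linfon {disp T R} m D a.

(** * The elastic energy *)

Section elastic_energy.
Context {disp} {T : measurableType disp} {R : realType}.
Context (m : {measure set T -> \bar R}) (D : set T) (n : nat).
Hypothesis mD : measurable D.
Implicit Types (l s : T -> R) (J K : T -> 'M[R]_n) (A B C : 'M[R]_n).

Definition symmetric_part A : 'M[R]_n := 2^-1 *: (A + A^T).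

(** The elastic energy density 2 mu e(u) : e(v) + lambda div u div v of two
    displacements with gradients A and B, s being the shear modulus mu and l
    the first Lame parameter lambda. *)
Definition energy_density (l s : R) A B : R :=
  2 * s * frob (symmetric_part A) (symmetric_part B) + l * (\tr A * \tr B).

Definition energy l s J K : R :=
  \int[m]_(x in D) energy_density (l x) (s x) (J x) (K x).

Definition L2field J := forall i j, L2on m D (fun x => J x i j).

Lemma energy_densityC (l s : R) A B :
  energy_density l s A B = energy_density l s B A.
Proof. by rewrite /energy_density frobC (mulrC (\tr A)). Qed.

Lemma energy_density_linear (l s c : R) A B C :
  energy_density l s (c *: A + B) C =
  c * energy_density l s A C + energy_density l s B C.
Proof.
have sympE : symmetric_part (c *: A + B) =
    c *: symmetric_part A + symmetric_part B.
  by apply/matrixP => i j; rewrite !mxE; ring.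
by rewrite /energy_density sympE frobDl frobZl mxtraceD mxtraceZ; ring.
Qed.

Lemma energy_density_ge0 (l s : R) A :
  0 <= l -> 0 <= s -> 0 <= energy_density l s A A.
Proof.
move=> l0 s0; apply: addr_ge0; apply: mulr_ge0 => //.
- exact: mulr_ge0.
- exact: frob_ge0.
- by rewrite -expr2 sqr_ge0.
Qed.

Lemma le_energy_density (l l' s s' : R) A :
  l <= l' -> s <= s' -> energy_density l s A A <= energy_density l' s' A A.
Proof.
move=> ll' ss'; apply: lerD; apply: ler_wpM2r => //.
- exact: frob_ge0.
- by rewrite ler_wpM2l.
- by rewrite -expr2 sqr_ge0.
Qed.

Lemma energyC l s J K : energy l s J K = energy l s K J.
Proof. by apply: eq_Rintegral => x _; rewrite energy_densityC. Qed.

Lemma L2field_linear (c : R) J K :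
  L2field J -> L2field K -> L2field (fun x => c *: J x + K x).
Proof.
move=> J2 K2 i j; under eq_fun do rewrite !mxE.
by apply: L2onD; [exact: L2onZ|].
Qed.

Lemma L2field_symmetric_part J :
  L2field J -> L2field (fun x => symmetric_part (J x)).
Proof.
move=> J2 i j; under eq_fun do rewrite !mxE.
by apply: L2onZ; exact: L2onD.
Qed.

Section fixed_moduli.
Variables (l s : T -> R).
Hypotheses (loo : Linfon m D l) (soo : Linfon m D s).

Lemma integrable_energy_density J K : L2field J -> L2field K ->
  m.-integrable D
    (EFin \o (fun x => energy_density (l x) (s x) (J x) (K x))).
Proof.
move=> J2 K2.
have tr2 H : L2field H -> L2on m D (fun x => \tr (H x)).
  by move=> H2; exact: L2on_sum.
have itr := integrable_weighted_product mD loo (tr2 _ J2) (tr2 _ K2).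
suff isym : m.-integrable D (EFin \o (fun x =>
    2 * s x * frob (symmetric_part (J x)) (symmetric_part (K x)))).
  exact: (eq_integrable mD _ _ _ (integrableD mD isym itr)).
rewrite (_ : _ \o _ = (fun x => \sum_i \sum_j (s x *
    (2 * symmetric_part (J x) i j * symmetric_part (K x) i j))%:E)%E).
  apply: (integrable_sum mD) => i _; apply: (integrable_sum mD) => j _.
  apply: (integrable_weighted_product mD soo).
    exact/L2onZ/L2field_symmetric_part.
  exact: L2field_symmetric_part.
apply/funext => x /=; under eq_bigr do rewrite sumEFin.
rewrite sumEFin /frob mulr_sumr; congr EFin; apply: eq_bigr => i _.
by rewrite mulr_sumr; apply: eq_bigr => j _; ring.
Qed.

Lemma energy_linear (c : R) J J' K : L2field J -> L2field J' -> L2field K ->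
  energy l s (fun x => c *: J x + J' x) K =
  c * energy l s J K + energy l s J' K.
Proof.
move=> J2 J'2 K2; rewrite /energy.
under eq_Rintegral do rewrite energy_density_linear.
have iJ := integrable_energy_density J2 K2.
rewrite RintegralD ?RintegralZl//; last exact: integrable_energy_density.
by apply: eq_integrable (integrableZl mD c iJ) => // x _.
Qed.

Lemma energy_ge0 J : L2field J ->
  {ae m, forall x, D x -> 0 <= l x} -> {ae m, forall x, D x -> 0 <= s x} ->
  0 <= energy l s J J.
Proof.
move=> J2 l0 s0.
have iJ := integrable_energy_density J2 J2.
rewrite /energy /Rintegral.
(* The density is nonnegative only almost everywhere, where it equals its
   absolute value. *)
rewrite (ae_eq_integral
  (fun x => `|energy_density (l x) (s x) (J x) (J x)|%:E)).
- by apply/fine_ge0/integral_ge0 => x _; rewrite lee_fin.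
- exact: mD.
- exact: measurable_int iJ.
- by apply/measurable_EFinP/measurableT_comp => //;
    exact/measurable_EFinP/(measurable_int _ iJ).
apply: filterS2 l0 s0 => x l0 s0 Dx; rewrite ger0_norm//.
by apply: energy_density_ge0; [exact: l0|exact: s0].
Qed.

Definition combination {M} (c : 'cV[R]_M) (J : 'I_M -> T -> 'M[R]_n) x :=
  \sum_k c k 0 *: J k x.

Lemma L2field_sum M (c : 'cV[R]_M) (J : 'I_M -> T -> 'M[R]_n) r :
  (forall k, L2field (J k)) -> L2field (fun x => \sum_(k <- r) c k 0 *: J k x).
Proof.
move=> J2; elim: r => [|k r ih].
  under eq_fun do rewrite big_nil.
  by move=> i j; under eq_fun do rewrite mxE; exact: L2on0.
by under eq_fun do rewrite big_cons; exact: L2field_linear.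
Qed.

Lemma energy_suml M (c : 'cV[R]_M) (J : 'I_M -> T -> 'M[R]_n) K r :
  (forall k, L2field (J k)) -> L2field K ->
  energy l s (fun x => \sum_(k <- r) c k 0 *: J k x) K =
  \sum_(k <- r) c k 0 * energy l s (J k) K.
Proof.
move=> J2 K2; elim: r => [|k r ih].
  rewrite big_nil /energy; under eq_Rintegral do rewrite big_nil.
  rewrite (_ : (fun x => _) = cst 0) ?Rintegral_cst ?mul0r//.
  apply/funext => x; have := energy_density_linear (l x) (s x) 1 0 0 (K x).
  by rewrite scaler0 addr0 mul1r /=; lra.
rewrite big_cons -ih -energy_linear//; last exact: L2field_sum.
by apply: eq_Rintegral => x _; rewrite big_cons.
Qed.

(** The quadratic form of a Gram matrix of the energy is the energy of the
    superposed field. *)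
Lemma qform_energy M (A : 'M[R]_M) (J K : 'I_M -> T -> 'M[R]_n) :
  (forall k, L2field (J k)) -> (forall k, L2field (K k)) ->
  (forall i j, A i j = energy l s (J j) (K i)) ->
  forall c, qform A c = energy l s (combination c J) (combination c K).
Proof.
move=> J2 K2 AE c; rewrite qformE energyC energy_suml//;
  last exact: L2field_sum.
apply: eq_bigr => i _; rewrite big_ord1 mxE; congr (_ * _).
rewrite energyC energy_suml//.
by apply: eq_bigr => j _; rewrite AE mulrC.
Qed.

End fixed_moduli.

Lemma le_energy l l' s s' J :
  Linfon m D l -> Linfon m D s -> Linfon m D l' -> Linfon m D s' ->
  L2field J ->
  (forall x, D x -> l x <= l' x) -> (forall x, D x -> s x <= s' x) ->
  energy l s J J <= energy l' s' J J.
Proof.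
move=> loo soo l'oo s'oo J2 ll' ss'; apply: le_Rintegral => //.
- exact: integrable_energy_density.
- exact: integrable_energy_density.
by move=> x Dx; apply: le_energy_density; [exact: ll'|exact: ss'].
Qed.

(** Write a and a' for the two energies, and E, E' for the superpositions of
    the fields J and J' with coefficients c.  The hypotheses say that
    a(E, E) = A[c] and a(E, E') = a'(E', E') = A'[c], and the energy grows with
    the moduli, so that
    0 <= a(E - E', E - E') = A[c] - 2 A'[c] + a(E', E') <= A[c] - A'[c]. *)
Lemma energy_loewner_le M l l' s s' (A A' : 'M[R]_M)
    (J J' : 'I_M -> T -> 'M[R]_n) :
  Linfon m D l -> Linfon m D s -> Linfon m D l' -> Linfon m D s' ->
  {ae m, forall x, D x -> 0 <= l x} -> {ae m, forall x, D x -> 0 <= s x} ->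
  (forall x, D x -> l x <= l' x) -> (forall x, D x -> s x <= s' x) ->
  (forall k, L2field (J k)) -> (forall k, L2field (J' k)) ->
  (forall i j, A i j = energy l s (J j) (J i)) ->
  (forall i j, A' i j = energy l s (J j) (J' i)) ->
  (forall i j, A' i j = energy l' s' (J' j) (J' i)) ->
  loewner_le A' A.
Proof.
move=> loo soo l'oo s'oo l0 s0 ll' ss' J2 J'2 AE A'E A'E' c.
have AcE := qform_energy loo soo J2 J2 AE c.
have A'cE := qform_energy loo soo J2 J'2 A'E c.
have A'cE' := qform_energy l'oo s'oo J'2 J'2 A'E' c.
set E := combination c J in AcE A'cE.
set E' := combination c J' in A'cE A'cE'.
have E2 : L2field E by exact: L2field_sum.
have E'2 : L2field E' by exact: L2field_sum.
pose F x := -1 *: E' x + E x.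
have F2 : L2field F by exact: L2field_linear.
have FE H : L2field H ->
    energy l s F H = -1 * energy l s E' H + energy l s E H.
  exact: energy_linear.
have := energy_ge0 loo soo F2 l0 s0.
rewrite FE// (energyC l s E' F) (energyC l s E F) !FE// (energyC l s E' E).
have := le_energy loo soo l'oo s'oo E'2 ll' ss'.
by rewrite -AcE -A'cE -A'cE'; lra.
Qed.

End elastic_energy.

(** * Patch integrals and monotonicity *)

Section boundary_integrals.
Context {disp} {T : measurableType disp} {R : realType} {n : nat}.
Context (m : {measure set T -> \bar R}).

(** Measurability is required of the extensions by 0, whose product is the
    integrand extended by 0 from A; as the load g vanishes off the patch P, it
    agrees almost everywhere with the extension from P. *)
Lemma Rintegral_frob_support (A B P : set T) (g t : T -> 'rV[R]_n) :
  A `<=` B -> P `<=` A -> measurable P ->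
  (forall i, measurable_fun setT ((fun x => g x 0 i) \_ A)) ->
  (forall i, measurable_fun setT ((fun x => t x 0 i) \_ B)) ->
  {ae m, forall x, A x -> ~ P x -> g x = 0} ->
  \int[m]_(x in P) frob (g x) (t x) = \int[m]_(x in A) frob (g x) (t x).
Proof.
move=> AB PA mP mg mt g0.
pose h := (fun x => frob (g x) (t x)) \_ A.
have mh : measurable_fun setT h.
  rewrite (_ : h = fun x => \sum_j
      ((fun x => g x 0 j) \_ A) x * ((fun x => t x 0 j) \_ B) x).
    by apply: measurable_sum => j; exact: measurable_funM.
  apply/funext => x; rewrite /h patchE; case: ifPn => xA; last first.
    by rewrite big1// => j _; rewrite patchE (negPf xA) mul0r.
  rewrite /frob big_ord1; apply: eq_bigr => j _; rewrite !patchE xA.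
  by rewrite ifT//; apply/mem_set/AB/set_mem.
have hP : (fun x => frob (g x) (t x)) \_ P = h \_ P.
  apply/funext => x; rewrite /h !patchE; case: ifPn => // xP.
  by rewrite ifT//; apply/mem_set/PA/set_mem.
rewrite Rintegral_mkcond [RHS]Rintegral_mkcond hP /Rintegral; congr fine.
apply: ae_eq_integral => //.
- apply/measurable_EFinP; apply/(measurable_restrictT h mP).
  exact: measurable_funS mh.
- exact/measurable_EFinP.
apply: filterS g0 => x g0 _ /=; rewrite -/h patchE; case: ifPn => // xP.
rewrite /h patchE; case: ifPn => // xA; rewrite g0.
- by rewrite -(scale0r 0) frobZl mul0r.
- exact: set_mem.
- by move=> /mem_set; exact/negP.
Qed.

End boundary_integrals.

Section monotonicity.
Context {R : realType} {d M : nat}.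
Implicit Types (Omega GD GN : set 'rV[R]_d) (lam mu : 'rV[R]_d -> R).

Lemma in_V_L2field Omega GD v :
  in_V Omega GD v -> L2field (leb R d) Omega (jac Omega v).
Proof.
move=> [vH1 _] i j; rewrite (_ : (fun x => _) =
    weak_partial Omega j (component v i)).
  by have [_ /(_ j)/(@xgetPex _ (cst 0))[]] := vH1 i.
by apply/funext => x; rewrite mxE.
Qed.

(** A function without trace is given the trace 0, which is measurable too. *)
Lemma measurable_trace Omega (f : 'rV[R]_d -> R) :
  measurable_fun (setT : set (caratheodory_type (hausdorff_om R d d.-1)))
    (trace Omega f \_ (bnd Omega)).
Proof.
rewrite /trace; have [[t ft]|nt] := pselect (exists t, is_trace Omega f t).
  have [/andP[+ _] _] := @xgetPex _ (cst 0) _ (ex_intro _ t ft).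
  by rewrite inE.
rewrite xgetPN => [|t ft]; last by apply: nt; exists t.
rewrite (_ : _ \_ _ = cst 0); first exact: measurable_cst.
by apply/funext => x; rewrite patchE; case: ifP.
Qed.

(** Testing the equation for the l-th load with v turns the measurement on
    the l-th patch into an energy: the load vanishes off the patch. *)
Lemma patch_integral_energy Omega GD GN (G : 'I_M -> set 'rV[R]_d)
    (g : 'I_M -> 'rV[R]_d -> 'rV[R]_d) lam mu k u v :
  rel_open (bnd Omega) GN -> boundary_loads GN G g ->
  weak_solution Omega GD GN lam mu (g k) u -> in_V Omega GD v ->
  \int[surf R d]_(x in G k) frob (g k x) (vtrace Omega v x) =
  energy (leb R d) Omega lam mu (jac Omega u) (jac Omega v).
Proof.
move=> [U _ GNE] [GGN _ gL2 g0] [_ usol] vV.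
rewrite [RHS](usol _ vV).
apply: (@Rintegral_frob_support _ _ R d (surf R d)
  GN (bnd Omega) (G k) (g k) (vtrace Omega v)).
- by rewrite GNE; exact: subIsetl.
- exact: (GGN k).1.
- exact: (GGN k).2.
- by move=> i; have /andP[+ _] := gL2 k i; rewrite inE.
- move=> i; rewrite (_ : (fun x => vtrace Omega v x 0 i) =
      trace Omega (component v i)).
    exact: measurable_trace.
  by apply/funext => x; rewrite mxE.
exact: g0.
Qed.

(** Stiffer materials yield less under the same loads.  Both solution families
    are admissible test fields for both equations, which provides the three
    Gram identities of [energy_loewner_le]. *)
Lemma ntd_loewner_le Omega GD GN (G : 'I_M -> set 'rV[R]_d)
    (g u u' : 'I_M -> 'rV[R]_d -> 'rV[R]_d) lam mu lam' mu' :
  open Omega -> rel_open (bnd Omega) GN -> boundary_loads GN G g ->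
  Linfty_pos Omega lam -> Linfty_pos Omega mu ->
  Linfty_pos Omega lam' -> Linfty_pos Omega mu' ->
  (forall k, weak_solution Omega GD GN lam mu (g k) (u k)) ->
  (forall k, weak_solution Omega GD GN lam' mu' (g k) (u' k)) ->
  (forall x, Omega x -> lam x <= lam' x) ->
  (forall x, Omega x -> mu x <= mu' x) ->
  loewner_le (ntd Omega G g u') (ntd Omega G g u).
Proof.
move=> oOmega oGN loads [lamoo lam0] [muoo mu0] [lam'oo _] [mu'oo _].
move=> usol u'sol lamlam' mumu'.
have uV k : in_V Omega GD (u k) by case: (usol k).
have u'V k : in_V Omega GD (u' k) by case: (u'sol k).
apply: (energy_loewner_le (open_measurable_leb oOmega) lamoo muoo lam'oo mu'oo
  (ae_pos_ge0 lam0) (ae_pos_ge0 mu0) lamlam' mumu'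
  (J := fun k => jac Omega (u k)) (J' := fun k => jac Omega (u' k))).
- by move=> k; exact: in_V_L2field (uV k).
- by move=> k; exact: in_V_L2field (u'V k).
- by move=> i j; rewrite mxE; exact: patch_integral_energy (usol j) (uV i).
- by move=> i j; rewrite mxE; exact: patch_integral_energy (usol j) (u'V i).
- by move=> i j; rewrite mxE; exact: patch_integral_energy (u'sol j) (u'V i).
Qed.

End monotonicity.

Section admissible_moduli.
Context {R : realType} {d N : nat} (Omega : set 'rV[R]_d).
Hypothesis oOmega : open Omega.

Lemma bounded_Linfty_pos (f : 'rV[R]_d -> R) (a b : R) :
  measurable_fun (setT : set (caratheodory_type (leb_om R d))) f ->
  0 < a -> (forall x, Omega x -> a <= f x <= b) -> Linfty_pos Omega f.
Proof.
move=> mf a0 fab; split.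
  apply: (@bounded_Linfon _ _ R (leb R d) Omega f b
    (open_measurable_leb oOmega)).
    exact: measurable_funS mf.
  by move=> x /fab/andP[af fb]; rewrite ger0_norm// (le_trans _ af)// ltW.
by exists a => //; apply: aeW => x /fab /andP[].
Qed.

Lemma cst_Linfty_pos (a : R) : 0 < a -> Linfty_pos Omega (cst a).
Proof.
move=> a0; apply: (@bounded_Linfty_pos _ a a) => // x _ /=.
by rewrite lexx.
Qed.

Variable omega : 'I_N -> set 'rV[R]_d.
Hypothesis oomega : forall s, open (omega s) /\ omega s `<=` Omega.

Lemma tau_in a b s x : omega s x -> tau Omega omega a b s x = b.
Proof.
move=> sx; rewrite /tau !indicE (mem_set sx) mulr1 memNset ?mulr0 ?add0r//.
by case.
Qed.

Lemma tau_out a b s x : Omega x -> ~ omega s x -> tau Omega omega a b s x = a.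
Proof.
move=> Ox sx; rewrite /tau !indicE (memNset sx) mulr0 addr0 mem_set ?mulr1//.
Qed.

Lemma tau_Linfty_pos a b s :
  0 < a -> 0 < b -> Linfty_pos Omega (tau Omega omega a b s).
Proof.
move=> a0 b0.
have mO := open_measurable_leb oOmega.
have ms := open_measurable_leb (oomega s).1.
apply: (@bounded_Linfty_pos _ (Num.min a b) (Num.max a b)).
- apply: measurable_funD; apply: measurable_funM;
    [exact: measurable_cst|apply: measurable_indic
    |exact: measurable_cst|exact: measurable_indic].
  exact: measurableD.
- by rewrite lt_min a0.
move=> x Ox; have [sx|sx] := pselect (omega s x).
  by rewrite tau_in// ge_min le_max lexx !orbT.
by rewrite tau_out// ge_min le_max lexx.
Qed.

End admissible_moduli.

(** * Resolution guarantee *)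

Theorem theorem2 (R : realType) (d N M : nat)
  (Omega GD GN : set 'rV[R]_d) (omega : 'I_N -> set 'rV[R]_d)
  (G : 'I_M -> set 'rV[R]_d) (g : 'I_M -> 'rV[R]_d -> 'rV[R]_d)
  (u : ('rV[R]_d -> R) -> ('rV[R]_d -> R) -> 'I_M -> 'rV[R]_d -> 'rV[R]_d)
  (c : constants R) :
  d = 2%N \/ d = 3%N ->
  elastic_domain Omega GD GN ->
  resolution_partition Omega omega ->
  boundary_loads GN G g ->
  (forall lam mu, Linfty_pos Omega lam -> Linfty_pos Omega mu ->
    forall k, unique_weak_solution Omega GD GN lam mu (g k) (u lam mu k)) ->
  valid_constants c ->
  weak_inclusion c ->
  let Lambda := fun lam mu => ntd Omega G g (u lam mu) in
  2 * delta c < nu Omega omega c Lambda ->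
  resolution_guarantee Omega omega c Lambda
    (reconstruct Omega omega c Lambda).
Proof.
move=> _ [[_ _ oOmega] _ _ _ [_ [_ oGN _]]] [oomega _ _] loads usol.
move=> [[lam0_gt0 mu0_gt0] [epsl_ge0 epsm_ge0] [cl_gt0 cm_gt0] delta_ge0
  [lamD_gt0 muD_gt0]] [lamDB muDB] Lambda nu_gt.
have Lambda_mono lam mu lam' mu' :
    Linfty_pos Omega lam -> Linfty_pos Omega mu ->
    Linfty_pos Omega lam' -> Linfty_pos Omega mu' ->
    (forall x, Omega x -> lam x <= lam' x /\ mu x <= mu' x) ->
    loewner_le (Lambda lam' mu') (Lambda lam mu).
  move=> lam_pos mu_pos lam'_pos mu'_pos le_mod.
  apply: (ntd_loewner_le oOmega oGN loads lam_pos mu_pos lam'_pos mu'_pos).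
  - by move=> k; case: (usol _ _ lam_pos mu_pos k) => + _; exact.
  - by move=> k; case: (usol _ _ lam'_pos mu'_pos k) => + _; exact.
  - by move=> x /le_mod[].
  - by move=> x /le_mod[].
have lamBmin_gt0 : 0 < lamB_min c by exact: lt_trans lamD_gt0 lamDB.
have muBmin_gt0 : 0 < muB_min c by exact: lt_trans muD_gt0 muDB.
have lamDBmax : lamD_max c <= lamB_max c.
  by rewrite /lamD_max /lamB_max; have := mulr_ge0 (ltW lam0_gt0) epsl_ge0; lra.
have muDBmax : muD_max c <= muB_max c.
  by rewrite /muD_max /muB_max; have := mulr_ge0 (ltW mu0_gt0) epsm_ge0; lra.
have taul_pos s :
    Linfty_pos Omega (tau Omega omega (lamB_max c) (lamD_max c) s).
  by apply: tau_Linfty_pos => //; exact: lt_le_trans lamDBmax.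
have taum_pos s :
    Linfty_pos Omega (tau Omega omega (muB_max c) (muD_max c) s).
  by apply: tau_Linfty_pos => //; exact: lt_le_trans muDBmax.
move=> D Lambda_noisy [DOmega [_ [lam [mu [lamB [muB [lamD [muD
  [[lam_pos mu_pos] inD outD boundB [boundD noise]]]]]]]]]].
split=> [s sD x sx|D0].
  exists s => //=; apply: loewner_le_noisy noise.
  apply: Lambda_mono => // z Oz.
  have [Dz|nDz] := pselect (D z).
    have [-> ->] := inD _ Dz; have [lamDz muDz] := boundD _ Dz.
    have [sz|sz] := pselect (omega s z).
      by rewrite !tau_in// /lamD_max /muD_max; split; lra.
    rewrite !tau_out//.
    by move: lamDBmax muDBmax; rewrite /lamD_max /muD_max; split; lra.
  have sz : ~ omega s z by move=> /sD.
  have ODz : (Omega `\` D) z by [].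
  have [-> ->] := outD _ ODz; have [] := boundB _ ODz.
  by rewrite !tau_out// /lamB_max /muB_max !ler_norml;
    move=> /andP[_ ?] /andP[_ ?]; split; lra.
apply/seteqP; split => // x [s /= marked_s _]; exfalso.
move: nu_gt; apply/negP; rewrite -leNgt.
pose B := Lambda (cst (lamB_min c)) (cst (muB_min c)).
apply: (@le_trans _ _ (sup (eig (Lambda_tau Omega omega c Lambda s - B)))).
  apply: ge_inf; last by exists s.
  pose F (s : 'I_N) := sup (eig (Lambda_tau Omega omega c Lambda s - B)).
  exists (\big[Num.min/F s]_t F t) => _ [t _ <-].
  exact: bigmin_le_cond.
apply: (sup_eig_noisy delta_ge0 marked_s noise).
apply: Lambda_mono => //; [exact: cst_Linfty_pos|exact: cst_Linfty_pos|].
move=> z Oz; have ODz : (Omega `\` D) z by rewrite D0 setD0.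
have [-> ->] := outD _ ODz; have [] := boundB _ ODz.
by rewrite /lamB_min /muB_min/= !ler_norml;
  move=> /andP[? _] /andP[? _]; split; lra.
Qed.
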